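(* Let $m,d,r\ge 1$ be integers and let $F:\mathbb{R}^{m\times d}\to\mathbb{R}$. For $B\in\mathbb{R}^{m\times r}$ define $\phi_B:\mathbb{R}^{r\times d}\to\mathbb{R}$ by $\phi_B(A)=F(BA)$. Assume that for every fixed $B\in\mathbb{R}^{m\times r}$: (i) $\phi_B$ is differentiable and there is a constant $L_A>0$ (possibly depending on $B$) such that $\lVert\nabla_A\phi_B(A_1)-\nabla_A\phi_B(A_2)\rVert_F\le L_A\lVert A_1-A_2\rVert_F$ for all $A_1,A_2\in\mathbb{R}^{r\times d}$; (ii) there is $\phi_B^{\inf}>-\infty$ such that $\phi_B(A)\ge\phi_B^{\inf}$ for all $A\in\mathbb{R}^{r\times d}$. Fix $B\in\mathbb{R}^{m\times r}$, with corresponding $L_A$ and $\phi_B^{\inf}$, a step size $0<\eta\le 1/L_A$, and an initial point $A_0\in\mathbb{R}^{r\times d}$, and let $A_{t+1}=A_t-\eta\nabla_A\phi_B(A_t)$ for $t\ge 0$. Then for every $t\ge 0$, $$\phi_B(A_{t+1})\le\phi_B(A_t)-\frac{\eta}{2}\lVert\nabla_A\phi_B(A_t)\rVert_F^2,$$ and for every integer $T\ge 1$, $$\min_{0\le t<T}\lVert\nabla_A\phi_B(A_t)\rVert_F^2\le\frac{2\big(\phi_B(A_0)-\phi_B^{\inf}\big)}{\eta T}.$$ In particular, choosing $\eta=1/L_A$ gives the $O(1/T)$ rate $$\min_{0\le t<T}\lVert\nabla_A\phi_B(A_t)\rVert_F^2\le\frac{2L_A\big(\phi_B(A_0)-\p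hi_B^{\inf}\big)}{T}.$$
   Context: $\lVert\cdot\rVert_F$ is the Frobenius norm, and $\nabla_A\phi_B(A)\in\mathbb{R}^{r\times d}$ is the gradient of $\phi_B$ with respect to the Frobenius inner product. *)

(* Defs.v *)
From HB Require Import structures.
From mathcomp Require Import all_boot all_order all_algebra.
From mathcomp Require Import boolp classical_sets reals topology normedtype.
From mathcomp Require Import derive.

Set Implicit Arguments.
Unset Strict Implicit.
Unset Printing Implicit Defensive.
Import Order.TTheory GRing.Theory Num.Theory.
Import numFieldNormedType.Exports.
Local Open Scope ring_scope.
Local Open Scope classical_set_scope.

Definition frob_dot (R : realType) (p q : nat) (X Y : 'M[R]_(p, q)) : R :=
  \sum_(i < p) \sum_(j < q) X i j * Y i j.

Definition frob_norm (R : realType) (p q : nat) (X : 'M[R]_(p, q)) : R :=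
  Num.sqrt (frob_dot X X).

(* G is the gradient at X of f when it represents the differential of f at X
   for the Frobenius inner product. The differential 'd f X is taken for the
   canonical (sup) norm on matrices; as all norms on 'M_(p, q) are equivalent,
   it is also the differential for the Frobenius norm. *)
Definition is_gradient (R : realType) (p q : nat) (f : 'M[R]_(p, q) -> R)
    (X G : 'M[R]_(p, q)) : Prop :=
  forall H : 'M[R]_(p, q), 'd f X H = frob_dot G H.

(* Well defined by [gradientP] and [is_gradient_unique]; meaningful only where
   f is differentiable, since 'd f X is a junk value elsewhere. *)
Definition gradient (R : realType) (p q : nat) (f : 'M[R]_(p, q) -> R)
    (X : 'M[R]_(p, q)) : 'M[R]_(p, q) :=
  get [set G | is_gradient f X G].

Lemma frob_dot_delta (R : realType) (p q : nat) (X : 'M[R]_(p, q)) i j :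
  frob_dot X (delta_mx i j) = X i j.
Proof.
rewrite /frob_dot (bigD1 i) //= (bigD1 j) //= mxE !eqxx mulr1.
rewrite big1 => [|k kj]; last by rewrite mxE eqxx (negbTE kj) mulr0.
rewrite addr0 big1 ?addr0 // => k ki.
by rewrite big1 // => l _; rewrite mxE (negbTE ki) mulr0.
Qed.

Lemma is_gradient_unique (R : realType) (p q : nat) (f : 'M[R]_(p, q) -> R)
    (X G G' : 'M[R]_(p, q)) :
  is_gradient f X G -> is_gradient f X G' -> G = G'.
Proof.
move=> hG hG'; apply/matrixP => i j.
by rewrite -frob_dot_delta -hG hG' frob_dot_delta.
Qed.

Lemma gradientP (R : realType) (p q : nat) (f : 'M[R]_(p, q) -> R)
    (X : 'M[R]_(p, q)) :
  is_gradient f X (gradient f X).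
Proof.
apply: (@getPex _ [set G | is_gradient f X G]).
exists (\matrix_(i, j) 'd f X (delta_mx i j)) => H.
rewrite {1}[H]matrix_sum_delta linear_sum; apply: eq_bigr => i _.
rewrite linear_sum; apply: eq_bigr => j _.
by rewrite linearZ mxE mulrC.
Qed.

Definition gradient_lipschitz (R : realType) (p q : nat)
    (f : 'M[R]_(p, q) -> R) (L : R) : Prop :=
  forall X1 X2 : 'M[R]_(p, q),
    frob_norm (gradient f X1 - gradient f X2) <= L * frob_norm (X1 - X2).

(* F as a function of the second factor, the first one being fixed. *)
Definition phi (R : realType) (m d r : nat) (F : 'M[R]_(m, d) -> R)
    (B : 'M[R]_(m, r)) (A : 'M[R]_(r, d)) : R :=
  F (B *m A).

(* The minimum of u 0, ..., u (T - 1) when T > 0: starting the iteration from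
   u 0, itself one of these values, does not change the result. *)
Definition min_upto (R : realType) (u : nat -> R) (T : nat) : R :=
  \big[Num.min/u 0%N]_(t < T) u t.

(* Main.v *)
(* Along the segment from X to X + H the map s |-> f (X + s H) has derivative
   <grad f (X + s H), H>, which exceeds its value at s = 0 by at most
   s L |H|^2; hence f (X + H) <= f X + <grad f X, H> + L/2 |H|^2. For
   H = - eta grad f X with eta L <= 1 this is the one-step decrease, and
   telescoping it bounds the sum, hence T times the minimum, of the squared
   gradient norms. *)
Require Import Defs.
From HB Require Import structures.
From mathcomp Require Import all_boot all_order all_algebra.
From mathcomp Require Import boolp classical_sets reals topology normedtype.
From mathcomp Require Import derive.
From mathcomp Require Import functions ring lra.

Set Implicit Arguments.
Unset Strict Implicit.
Unset Printing Implicit Defensive.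
Import Order.TTheory GRing.Theory Num.Theory.
Import numFieldNormedType.Exports.
Local Open Scope ring_scope.

Lemma frob_dotC (R : realType) (p q : nat) (X Y : 'M[R]_(p, q)) :
  frob_dot X Y = frob_dot Y X.
Proof.
by apply: eq_bigr => i _; apply: eq_bigr => j _; rewrite mulrC.
Qed.

Lemma frob_dotDl (R : realType) (p q : nat) (X Y Z : 'M[R]_(p, q)) :
  frob_dot (X + Y) Z = frob_dot X Z + frob_dot Y Z.
Proof.
rewrite -big_split; apply: eq_bigr => i _.
by rewrite -big_split; apply: eq_bigr => j _; rewrite mxE mulrDl.
Qed.

Lemma frob_dotZl (R : realType) (p q : nat) a (X Y : 'M[R]_(p, q)) :
  frob_dot (a *: X) Y = a * frob_dot X Y.
Proof.
rewrite mulr_sumr; apply: eq_bigr => i _.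
by rewrite mulr_sumr; apply: eq_bigr => j _; rewrite mxE mulrA.
Qed.

Lemma frob_dotBl (R : realType) (p q : nat) (X Y Z : 'M[R]_(p, q)) :
  frob_dot (X - Y) Z = frob_dot X Z - frob_dot Y Z.
Proof. by rewrite -scaleN1r frob_dotDl frob_dotZl mulN1r. Qed.

Lemma frob_dot_ge0 (R : realType) (p q : nat) (X : 'M[R]_(p, q)) :
  0 <= frob_dot X X.
Proof.
by apply: sumr_ge0 => i _; apply: sumr_ge0 => j _; rewrite -expr2 sqr_ge0.
Qed.

Lemma frob_norm_sqr (R : realType) (p q : nat) (X : 'M[R]_(p, q)) :
  frob_norm X ^+ 2 = frob_dot X X.
Proof. exact/sqr_sqrtr/frob_dot_ge0. Qed.

Lemma frob_normZ (R : realType) (p q : nat) a (X : 'M[R]_(p, q)) :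
  frob_norm (a *: X) = `|a| * frob_norm X.
Proof.
rewrite /frob_norm frob_dotZl frob_dotC frob_dotZl mulrA -expr2.
by rewrite sqrtrM ?sqr_ge0 // sqrtr_sqr.
Qed.

(* The case of Cauchy-Schwarz needed here, read off [0 <= |D - k H|^2]. *)
Lemma frob_dot_le_normM (R : realType) (p q : nat) (k : R)
    (D H : 'M[R]_(p, q)) :
  0 < k -> frob_norm D <= k * frob_norm H ->
  frob_dot D H <= k * frob_norm H ^+ 2.
Proof.
move=> k_gt0 leDH.
have := frob_dot_ge0 (D - k *: H).
have : frob_norm D ^+ 2 <= (k * frob_norm H) ^+ 2.
  by rewrite lerXn2r ?nnegrE ?mulr_ge0 ?sqrtr_ge0 // ltW.
rewrite exprMn !frob_norm_sqr frob_dotBl frob_dotZl.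
rewrite ![frob_dot _ (_ - _)]frob_dotC !frob_dotBl !frob_dotZl.
rewrite [frob_dot H D]frob_dotC => leDD ge0.
(* After scaling by [k]: [2k<D,H> <= |D|^2 + k^2 |H|^2 <= 2k^2 |H|^2]. *)
rewrite -(ler_pM2l k_gt0); nra.
Qed.

(** Chain rule: the affine map [u |-> X + u *: H] has differential [u |-> u *: H] everywhere, and
    [gradientP] turns the differential of [f] in the direction [H] into a scalar product. *)
Lemma is_derive_line (R : realType) (p q : nat) (f : 'M[R]_(p, q) -> R)
    (X H : 'M[R]_(p, q)) (s : R) :
  differentiable f (X + s *: H) ->
  is_derive s 1 (fun u : R => f (X + u *: H))
    (frob_dot (gradient f (X + s *: H)) H).
Proof.
move=> df.
pose g : R -> 'M[R]_(p, q) := cst X + *:%R ^~ H.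
have dg : is_diff s g (0 + *:%R ^~ H) by exact: is_diffD.
have dfg : differentiable (f \o g) s.
  by apply: differentiable_comp => //; exact: ex_diff.
apply: DeriveDef; first exact/derivable1_diffP.
rewrite (deriveE (1 : R) dfg) diff_comp; [|exact: ex_diff|exact: df].
by rewrite /= diff_val !fctE add0r scale1r gradientP.
Qed.

Lemma descent_lemma (R : realType) (p q : nat) (f : 'M[R]_(p, q) -> R)
    (L : R) (X H : 'M[R]_(p, q)) :
  (forall Y, differentiable f Y) -> 0 < L -> gradient_lipschitz f L ->
  f (X + H) <= f X + frob_dot (gradient f X) H + L / 2 * frob_norm H ^+ 2.
Proof.
move=> df L_gt0 lip.
set c := frob_dot _ H; set n := frob_norm H ^+ 2.
(* Subtracting the linear and quadratic terms of the bound makes the claim [h 1 <= h 0], so the mean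
   value theorem replaces an integral of the gradient along the segment. *)
pose h : R -> R :=
  (fun u : R => f (X + u *: H)) - c *: id - (L / 2 * n) *: (id ^+ 2).
pose dh (s : R) := frob_dot (gradient f (X + s *: H)) H - c - L * s * n.
have hd (s : R) : is_derive s 1 h (dh s).
  have dl := @is_derive_line _ _ _ f X H s (df _).
  apply: is_derive_eq.
  by rewrite /dh /GRing.scale /= expr1 mulr1; field.
have hc : {within `[0, 1], continuous h}%classic.
  apply: derivable_within_continuous => s _; exact: ex_derive.
have [s s01 hE] := MVT ltr01 (fun s _ => hd s) hc.
have /andP[s_gt0 _] : 0 < s < 1 by rewrite in_itv in s01.
have : dh s <= 0.
  (* Cauchy-Schwarz with [k = L * s], positive because the mean value point is interior; the
     Lipschitz bound between [X + s *: H] and [X] is then its premise. *)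
  rewrite /dh subr_le0 -frob_dotBl frob_dot_le_normM ?mulr_gt0 //.
  by apply: le_trans (lip _ _) _; rewrite addrC addKr frob_normZ gtr0_norm // mulrA.
move: hE; rewrite subr0 mulr1 => <-.
rewrite /h !fctE scale1r scale0r addr0 /GRing.scale /=; lra.
Qed.

Lemma gradient_step_le (R : realType) (p q : nat) (f : 'M[R]_(p, q) -> R)
    (L eta : R) (X : 'M[R]_(p, q)) :
  (forall Y, differentiable f Y) -> 0 < L -> gradient_lipschitz f L ->
  0 < eta -> eta <= 1 / L ->
  f (X - eta *: gradient f X) <= f X - eta / 2 * frob_norm (gradient f X) ^+ 2.
Proof.
move=> df L_gt0 lip eta_gt0; rewrite ler_pdivlMr // => etaL.
have := descent_lemma X (- eta *: gradient f X) df L_gt0 lip.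
rewrite frob_normZ frob_dotC frob_dotZl -frob_norm_sqr scaleNr.
rewrite normrN gtr0_norm // exprMn => /le_trans; apply.
set n := frob_norm _ ^+ 2.
have n_ge0 : 0 <= n by exact: sqr_ge0.
(* Half of this quantity is the gap between the descent bound [- eta * n + L / 2 * eta ^+ 2 * n] and
   the target [- eta / 2 * n]. *)
have : 0 <= eta * n * (1 - eta * L).
  by apply: mulr_ge0; [exact: mulr_ge0 (ltW _) _ | rewrite subr_ge0].
nra.
Qed.

Lemma min_upto_le_mean (R : realType) (u : nat -> R) (T : nat) :
  min_upto u T * T%:R <= \sum_(t < T) u t.
Proof.
rewrite mulr_natr -[X in _ *+ X]card_ord -sumr_const.
by apply: ler_sum => t _; exact: bigmin_le.
Qed.

(** The rate uses only real sequences: [v] stands for the function values, [u] for the squared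
    gradient norms and [c] for the step size. *)
Lemma min_upto_le_of_decrease (R : realType) (v u : nat -> R) (c b : R)
    (T : nat) :
  0 < c -> (forall t, v t.+1 <= v t - c / 2 * u t) -> (forall t, b <= v t) ->
  (1 <= T)%N -> min_upto u T <= 2 * (v 0%N - b) / (c * T%:R).
Proof.
move=> c_gt0 dec lb T_gt0.
(* The last value [v n] is kept so that the induction telescopes; the lower bound [b] replaces it
   only at the end. *)
have sum_le n : c / 2 * \sum_(t < n) u t <= v 0%N - v n.
  elim: n => [|n IHn]; first by rewrite big_ord0 mulr0 subrr.
  by rewrite big_ord_recr mulrDr /=; have := dec n; lra.
have mT := min_upto_le_mean u T.
rewrite ler_pdivlMr ?mulr_gt0 ?ltr0n //.
have : c / 2 * (min_upto u T * T%:R) <= c / 2 * \sum_(t < T) u t.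
  by rewrite ler_pM2l // divr_gt0.
have := sum_le T; have := lb T; lra.
Qed.

Theorem theorem2 (R : realType) (m d r : nat)
  (hm : (1 <= m)%N) (hd : (1 <= d)%N) (hr : (1 <= r)%N)
  (F : 'M[R]_(m, d) -> R)
  (h_diff : forall (B : 'M[R]_(m, r)) (A : 'M[R]_(r, d)),
     differentiable (phi F B) A)
  (h_lip : forall B : 'M[R]_(m, r),
     exists L_A : R, 0 < L_A /\ gradient_lipschitz (phi F B) L_A)
  (h_inf : forall B : 'M[R]_(m, r),
     exists phi_inf : R, forall A : 'M[R]_(r, d), phi_inf <= phi F B A)
  (B : 'M[R]_(m, r))
  (L_A : R) (hL_A : 0 < L_A) (hB_lip : gradient_lipschitz (phi F B) L_A)
  (phi_inf : R) (hB_inf : forall A : 'M[R]_(r, d), phi_inf <= phi F B A)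
  (eta : R) (heta0 : 0 < eta) (heta : eta <= 1 / L_A)
  (A : nat -> 'M[R]_(r, d))
  (hA : forall t : nat, A t.+1 = A t - eta *: gradient (phi F B) (A t)) :
  (forall t : nat,
     phi F B (A t.+1) <=
       phi F B (A t) - eta / 2 * frob_norm (gradient (phi F B) (A t)) ^+ 2)
  /\ (forall T : nat, (1 <= T)%N ->
     min_upto (fun t => frob_norm (gradient (phi F B) (A t)) ^+ 2) T <=
       2 * (phi F B (A 0%N) - phi_inf) / (eta * T%:R))
  /\ (eta = 1 / L_A -> forall T : nat, (1 <= T)%N ->
     min_upto (fun t => frob_norm (gradient (phi F B) (A t)) ^+ 2) T <=
       2 * L_A * (phi F B (A 0%N) - phi_inf) / T%:R).
Proof.
have dec t : phi F B (A t.+1) <=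
    phi F B (A t) - eta / 2 * frob_norm (gradient (phi F B) (A t)) ^+ 2.
  by rewrite hA; exact: (gradient_step_le _ (h_diff B) hL_A).
have rate T : (1 <= T)%N ->
    min_upto (fun t => frob_norm (gradient (phi F B) (A t)) ^+ 2) T <=
      2 * (phi F B (A 0%N) - phi_inf) / (eta * T%:R).
  exact: min_upto_le_of_decrease (fun t => phi F B (A t)) _ _ _ _ heta0 dec _.
split=> //; split=> // eta_eq T T_gt0.
apply: le_trans (rate T T_gt0) _.
(* At [eta = 1 / L_A] the two bounds coincide; clearing denominators requires [T] and [L_A] to be
   nonzero. *)
rewrite eta_eq le_eqVlt; apply/orP; left; apply/eqP; field.
by rewrite pnatr_eq0 -lt0n T_gt0 gt_eqF.
Qed.
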